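(* Let $P(z)=\sum_{j=0}^{n}a_jz^j$, where $n\ge 1$, be a polynomial with complex coefficients and let $z_0\in\mathbb{C}$ be a point of local maximum of $|P|$. Then $P$ is a constant.
   Context: The leading coefficient $a_n$ is not required to be nonzero. A local maximum is not required to be strict. *)

(* Defs.v *)
From mathcomp Require Import all_boot all_order all_algebra.
From mathcomp Require Import complex.
From mathcomp Require Import boolp classical_sets reals topology normedtype.
Import numFieldNormedType.Exports.

Set Implicit Arguments.
Unset Strict Implicit.
Unset Printing Implicit Defensive.

Import Order.TTheory GRing.Theory Num.Theory.
Local Open Scope classical_set_scope.
Local Open Scope ring_scope.

(* The inequality is non-strict and the neighborhood contains x itself.      *)
(* For K = R[i], the order is partial, x <= y meaning that y - x is a        *)
(* nonnegative real, so [is_local_max f x] makes sense as usual when f takes *)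
(* real values, as does the modulus `|_| : R[i] -> R[i].                     *)
Definition is_local_max (T : topologicalType) (K : numDomainType)
  (f : T -> K) (x : T) : Prop := \forall y \near x, f y <= f x.

(* Main.v *)
Require Import Defs.
From mathcomp Require Import all_boot all_order all_algebra.
From mathcomp Require Import complex.
From mathcomp Require Import boolp classical_sets reals topology normedtype.
Import Order.TTheory GRing.Theory Num.Theory.
Import numFieldNormedType.Exports.
Local Open Scope ring_scope.
Local Open Scope complex_scope.

(** A nonconstant polynomial P is, near z0, governed by the first nonzero term
    of its Taylor expansion after the constant one: with w = z - z0,
    P z = P z0 + b w ^ k + O(w ^ (k + 1)), b != 0, k > 0. Over an algebraically
    closed field, k-th roots exist, so w can be given a direction for which
    b w ^ k is a positive multiple of P z0 (or of 1 if P z0 = 0). Then the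
    moduli of the first two terms add up, and for small w their sum exceeds the
    modulus of the remainder by more than the modulus of P z0. So every
    neighborhood of z0 contains a point where the modulus of P is larger than
    at z0 ([norm_horner_increases]), and z0 is not a local maximum.

    The argument is carried out over an arbitrary [numClosedFieldType], whose
    order is partial: there the small radius is the inverse of a sum of
    nonnegative terms, one for each upper bound wanted, instead of a minimum. *)

Lemma ler_norm_horner_sum (K : numDomainType) (p : {poly K}) (x r : K) :
  `|x| <= r -> `|p.[x]| <= \sum_(i < size p) `|p`_i| * r ^+ i.
Proof.
move=> xr; rewrite horner_coef; apply: le_trans (ler_norm_sum _ _ _) _.
apply: ler_sum => i _; rewrite normrM normrX ler_wpM2l //.
by apply: lerXn2r; rewrite ?nnegrE // (le_trans _ xr).
Qed.

Lemma horner_sub_lipschitz (K : numFieldType) (p : {poly K}) (a : K) :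
  exists2 M : K, 0 <= M &
    forall w, `|w| <= 1 -> `|p.[a + w] - p.[a]| <= M * `|w|.
Proof.
have /factor_theorem [q pE] : root (p - p.[a]%:P) a.
  by rewrite rootE !hornerE subrr.
exists (\sum_(i < size q) `|q`_i| * (`|a| + 1) ^+ i).
  by apply: sumr_ge0 => i _; rewrite mulr_ge0 ?exprn_ge0 ?addr_ge0.
move=> w w1; have := congr1 (horner^~ (a + w)) pE.
rewrite !hornerE [a + w - a]addrAC subrr add0r => ->.
rewrite normrM ler_wpM2r // ler_norm_horner_sum //.
by rewrite (le_trans (ler_normD _ _)) // lerD2l.
Qed.

(** Write P = P z0 + S * (X - z0) ^ k with S z0 != 0. The direction u is a k-th
    root chosen so that S z0 u ^ k = d, where d is P z0, or 1 if P z0 = 0; the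
    point is z0 + t u for small t > 0. The remainder is (S z - S z0)(t u) ^ k,
    one order smaller since S is Lipschitz near z0. *)
Lemma norm_horner_increases (K : numClosedFieldType) (P : {poly K}) (z0 e : K) :
    (1 < size P)%N -> 0 < e ->
  exists2 z, `|z - z0| < e & `|P.[z0]| < `|P.[z]|.
Proof.
move=> sP e0; set c := P.[z0].
have Pc0 : P - c%:P != 0.
  by apply: contraTneq sP => /subr0_eq ->; rewrite -leqNgt size_polyC leq_b1.
have [k [S]] := multiplicity_XsubC (P - c%:P) z0.
rewrite Pc0 /= rootE => b0 PE.
have k0 : (0 < k)%N.
  rewrite lt0n; apply: contraNneq b0 => k0; move: PE; rewrite k0 mulr1 => <-.
  by rewrite !hornerE subrr.
pose d : K := if c == 0 then 1 else c.
have d0 : 0 < `|d|.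
  by rewrite normr_gt0 /d; case: ifPn => // _; rewrite oner_neq0.
have normD_d s : 0 <= s -> `|c + s * d| = `|c| + s * `|d|.
  move=> s0; rewrite /d; case: ifPn => [/eqP ->|_].
    by rewrite normr0 !add0r normrM ger0_norm.
  by rewrite -{1}[c]mul1r -mulrDl normrM ger0_norm ?addr_ge0 // mulrDl mul1r.
pose u : K := k.-root (d / S.[z0]).
have uk : S.[z0] * u ^+ k = d by rewrite rootCK // mulrC divfK.
have [M M0 SM] := horner_sub_lipschitz K S z0.
(* The terms of A after the first make t |u| < 1, t |u| < e and
   t M |u| ^ (k + 1) < |d|; the first makes these inequalities strict. *)
pose A : K := 1 + `|u| + `|u| / e + M * `|u| ^+ k.+1 / `|d|.
have q0 : 0 <= `|u| / e by rewrite divr_ge0 // ltW.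
have r0 : 0 <= M * `|u| ^+ k.+1 / `|d|.
  by rewrite divr_ge0 // mulr_ge0 // exprn_ge0.
have A0 : 0 < A by rewrite /A -!addrA ltr_pwDl // !addr_ge0.
pose t : K := A^-1.
have t0 : 0 < t by rewrite invr_gt0.
have tlt1 x : x < A -> t * x < 1 by move=> xA; rewrite mulrC ltr_pdivrMr // mul1r.
have tu : `|t * u| = t * `|u| by rewrite normrM gtr0_norm.
have tu1 : t * `|u| < 1.
  apply: tlt1; rewrite /A -addrA [1 + _]addrC -addrA ltrDl.
  by rewrite ltr_pwDl // addr_ge0.
have tue : t * `|u| < e.
  rewrite -[ltRHS]mul1r -ltr_pdivrMr // -mulrA tlt1 //.
  by rewrite /A addrAC ltrDr -addrA ltr_pwDl // addr_ge0.
have tMd : t * (M * `|u| ^+ k.+1) < `|d|.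
  rewrite -[ltRHS]mul1r -ltr_pdivrMr // -mulrA tlt1 //.
  by rewrite /A ltrDr -addrA ltr_pwDl // addr_ge0.
exists (z0 + t * u); first by rewrite addrAC subrr add0r tu.
pose rem := (S.[z0 + t * u] - S.[z0]) * (t * u) ^+ k.
have PzE : P.[z0 + t * u] = c + t ^+ k * d + rem.
  rewrite -[P](subrK c%:P) PE !hornerE.
  rewrite [z0 + _ - z0]addrAC subrr add0r /rem mulrBl -uk exprMn.
  rewrite [_ + c]addrC -addrA; congr (_ + _).
  by rewrite [t ^+ k * (_ * _)]mulrCA addrC subrK.
have rem_lt : `|rem| < t ^+ k * `|d|.
  rewrite /rem normrM normrX tu.
  apply: (@le_lt_trans _ _ (t ^+ k * (t * (M * `|u| ^+ k.+1)))).
    apply: (@le_trans _ _ (M * (t * `|u|) * (t * `|u|) ^+ k)).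
      rewrite ler_wpM2r ?exprn_ge0 ?mulr_ge0 ?(ltW t0) //.
      by rewrite -tu SM // tu ltW.
    by rewrite -mulrA -exprS exprMn mulrCA [t ^+ k.+1]exprSr -mulrA.
  by rewrite ltr_pM2l // exprn_gt0.
rewrite PzE; apply: lt_le_trans (lerB_normD _ _).
by rewrite normD_d ?exprn_ge0 ?(ltW t0) // -addrA ltrDl subr_gt0.
Qed.

(* The regular algebra R[i]^o is the copy of R[i] on which the topology of   *)
(* the modulus is canonically available.                                     *)
Theorem theorem6p4 (R : realType) (n : nat) (hn : (1 <= n)%N)
  (a : 'I_n.+1 -> R[i]) (P : {poly R[i]})
  (hP : P = \sum_(j < n.+1) a j *: 'X^j) (z0 : R[i])
  (hz0 : is_local_max (fun z : R[i]^o => `|P.[z]|) (z0 : R[i]^o)) :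
  exists c : R[i], P = c%:P.
Proof.
have [/size1_polyC ->|sP] := leqP (size P) 1; first by exists P`_0.
have [e e0 emax] := (nbhs_ballP (z0 : R[i]^o) _).1 hz0.
have [z ze lt_P] := norm_horner_increases _ P z0 e sP e0.
have := emax z; rewrite -ball_normE /= distrC => /(_ ze) /le_lt_trans /(_ lt_P).
by rewrite ltxx.
Qed.
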